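(* The restriction of a strong Daugavet operator on an $\ell_1$-sum to a summand need not be a strong Daugavet operator. That is, there exist real Banach spaces $X_1,X_2,Y$ and a strong Daugavet operator $T: X_1\oplus_1 X_2\to Y$ on $X_1\oplus_1 X_2$ such that the restriction $T_1: X_1\to Y$, $T_1x_1=T(x_1,0)$, is not a strong Daugavet operator on $X_1$.
   Context: All Banach spaces are real; $S(X)$ denotes the unit sphere of $X$. $X_1\oplus_1 X_2$ is the direct sum with norm $\|(x_1,x_2)\|=\|x_1\|+\|x_2\|$. A bounded linear operator $T$ from a Banach space $X$ to some Banach space $Y$ is a strong Daugavet operator (on $X$) if for all $x,y\in S(X)$ and every $\varepsilon>0$ there is $z\in S(X)$ with $\|x+z\|\ge 2-\varepsilon$ and $\|T(y-z)\|\le\varepsilon$. *)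

(* Defs.v *)
From HB Require Import structures.
From mathcomp Require Import all_boot all_order all_algebra.
From mathcomp Require Import all_classical all_reals all_analysis.

Set Implicit Arguments.
Unset Strict Implicit.
Unset Printing Implicit Defensive.

Import Order.TTheory GRing.Theory Num.Theory.
Import numFieldNormedType.Exports.

Local Open Scope classical_set_scope.
Local Open Scope ring_scope.

(* The normed structure that MathComp-Analysis puts on [X1 * X2] is the
   max norm.  [l1sum] is an alias of the product that inherits only its linear
   structure and is given the norm [`|x.1| + `|x.2|] together with the
   topology that this norm induces. *)
Definition l1sum (R : realType) (X1 X2 : normedModType R) : Type :=
  (X1 * X2)%type.

Section L1SumNormed.
Context (R : realType) (X1 X2 : normedModType R).

HB.instance Definition _ := GRing.Lmodule.copy (l1sum X1 X2) (X1 * X2)%type.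

Definition l1norm (x : l1sum X1 X2) : R := `|x.1| + `|x.2|.

Fact l1norm_triangle (x y : l1sum X1 X2) :
  l1norm (x + y) <= l1norm x + l1norm y.
Proof. by rewrite /l1norm addrACA lerD// ler_normD. Qed.

Fact l1normZ (a : R) (x : l1sum X1 X2) : l1norm (a *: x) = `|a| * l1norm x.
Proof. by rewrite /l1norm !normrZ mulrDr. Qed.

Fact l1norm0_eq0 (x : l1sum X1 X2) : l1norm x = 0 -> x = 0.
Proof.
case: x => x1 x2 /eqP; rewrite /l1norm paddr_eq0//= !normr_eq0.
by move=> /andP[/eqP -> /eqP ->].
Qed.

HB.instance Definition _ := Lmodule_isNormed.Build R (l1sum X1 X2)
  l1norm_triangle l1normZ l1norm0_eq0.

Lemma l1sum_normE (x : l1sum X1 X2) : `|x| = `|x.1| + `|x.2|.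
Proof. by []. Qed.

Definition l1inl (x1 : X1) : l1sum X1 X2 := (x1, 0).

Fact l1inl_is_linear : linear l1inl.
Proof.
move=> a x y; rewrite /l1inl; apply/pair_equal_spec.
by split => //=; rewrite scaler0 addr0.
Qed.

HB.instance Definition _ :=
  GRing.isLinear.Build R X1 (l1sum X1 X2) *:%R l1inl l1inl_is_linear.

Lemma norm_l1inl (x1 : X1) : `|l1inl x1| = `|x1|.
Proof. by rewrite l1sum_normE/= normr0 addr0. Qed.

End L1SumNormed.

Section L1SumComplete.
Context (R : realType) (X1 X2 : completeNormedModType R).

Fact l1sum_complete (F : set_system (l1sum X1 X2)) :
  ProperFilter F -> cauchy F -> cvg F.
Proof.
move=> FF /cauchy_ballP Fc; apply/cvg_ex.
have c1 : cauchy ((fun x : l1sum X1 X2 => x.1 : X1) @ F).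
  apply/cauchy_ballP => e e0; have := Fc e e0.
  move=> [[A B] /= [FA FB] AB]; exists ([set x.1 | x in A], [set x.1 | x in B]).
    by split => /=; [apply: filterS FA|apply: filterS FB] => x ?; exists x.
  move=> [_ _] /= [[x Ax <-] [y By <-]]; have /= := AB (x, y) (conj Ax By).
  by rewrite -!ball_normE/=; apply: le_lt_trans; rewrite l1sum_normE lerDl.
have c2 : cauchy ((fun x : l1sum X1 X2 => x.2 : X2) @ F).
  apply/cauchy_ballP => e e0; have := Fc e e0.
  move=> [[A B] /= [FA FB] AB]; exists ([set x.2 | x in A], [set x.2 | x in B]).
    by split => /=; [apply: filterS FA|apply: filterS FB] => x ?; exists x.
  move=> [_ _] /= [[x Ax <-] [y By <-]]; have /= := AB (x, y) (conj Ax By).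
  by rewrite -!ball_normE/=; apply: le_lt_trans; rewrite l1sum_normE lerDr.
have /cauchy_cvg/cvg_ex[l1 /cvgrPdist_lt F1] := c1.
have /cauchy_cvg/cvg_ex[l2 /cvgrPdist_lt F2] := c2.
exists ((l1, l2) : l1sum X1 X2); apply/cvgrPdist_lt => e e0.
have e20 : 0 < e / 2 by rewrite divr_gt0.
near=> x.
rewrite l1sum_normE (splitr e) ltrD//; near: x.
- exact: F1.
- exact: F2.
Unshelve. all: by end_near. Qed.

HB.instance Definition _ :=
  Uniform_isComplete.Build (l1sum X1 X2) l1sum_complete.

End L1SumComplete.

Definition strong_daugavet (R : realType) (X Y : completeNormedModType R)
    (T : {linear X -> Y}) : Prop :=
  bounded_near T (nbhs (0 : X)) /\
  forall x y : X, `|x| = 1 -> `|y| = 1 -> forall eps : R, 0 < eps ->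
    exists z : X, [/\ `|z| = 1, 2 - eps <= `|x + z| & `|T (y - z)| <= eps].

(* The restriction to a summand is again bounded, so when it fails to be a
   strong Daugavet operator the failure lies in the second clause. *)
Lemma bounded_l1inl (R : realType) (X1 X2 Y : completeNormedModType R)
    (T : {linear l1sum X1 X2 -> Y}) :
  bounded_near T (nbhs (0 : l1sum X1 X2)) ->
  bounded_near (T \o @l1inl R X1 X2) (nbhs (0 : X1)).
Proof.
move=> /bounded_funP Tb; apply/bounded_funP => r.
have [M TM] := Tb r; exists M => x xr /=.
by apply: TM; rewrite norm_l1inl.
Qed.

(* Main.v *)
Require Import Defs.
From HB Require Import structures.
From mathcomp Require Import all_boot all_order all_algebra.
From mathcomp Require Import all_classical all_reals all_analysis.
From mathcomp Require Import lra.
Import Order.TTheory GRing.Theory Num.Theory.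
Import numFieldNormedType.Exports.
Local Open Scope ring_scope.
Local Open Scope classical_set_scope.

Set Implicit Arguments.
Unset Strict Implicit.

(** The counterexample takes for [X1] and [Y] the real line, for [X2] the space
    [c] of convergent real sequences under the sup norm, and
    [T (a, u) = a + lim u].

    On the summand [R] the operator [T] restricts to the identity, which is not
    strong Daugavet: for [x = 1] and [y = -1] the two requirements on [z] ask
    that [|1 + z|] be close to 2 and close to 0.

    On the whole sum, [T] has norm at most 1, so [t = T y] lies in [[-1, 1]]
    for every unit vector [y].  A unit vector [z = (0, v)] can then meet both
    requirements because, in [c], changing one coordinate of a sequence does
    not affect its limit.  Given a unit vector [x = (a, u)], choose an index
    [m] at which [|u m|] is within [eps] of the norm of [u], and let [v] be the
    sequence that is constantly [t] except for [v m = 1] or [v m = -1],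
    with the sign of [u m].  Then [T z = lim v = t] exactly, while
    [|x + z| >= |a| + |u m| + 1 >= 2 - eps]
    ([addlim_strong_daugavet]).

    The analytic input is that [c] is a Banach space: a uniform limit of
    convergent sequences converges, by the exchange of limits
    ([cseq_complete]). *)

(** * The Banach space of convergent sequences *)

Section ConvergentSequences.
Context (R : realType).

Definition convergent : {pred nat -> R^o} := [pred u | `[< cvgn u >]].

Fact convergent_submod_closed : submod_closed convergent.
Proof.
split=> [|a u v /asboolP cu /asboolP cv]; apply/asboolP.
  exact: is_cvg_cst.
by apply: is_cvgD => //; apply: is_cvgZl_tmp.
Qed.

HB.instance Definition _ :=
  GRing.isSubmodClosed.Build R (nat -> R^o) convergent convergent_submod_closed.

Record cseq := Cseq { cseq_val :> nat -> R^o; _ : cseq_val \in convergent }.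

HB.instance Definition _ := [isSub of cseq for cseq_val].
HB.instance Definition _ := [Choice of cseq by <:].
HB.instance Definition _ := [SubChoice_isSubLmodule of cseq by <:].

Lemma cseq_cvg (u : cseq) : cvgn u.
Proof. by case: u => u /= /asboolP. Qed.

Lemma cseqDE (u v : cseq) n : (u + v) n = u n + v n. Proof. by []. Qed.

Lemma cseqBE (u v : cseq) n : (u - v) n = u n - v n. Proof. by []. Qed.

Lemma cseqZE (a : R) (u : cseq) n : (a *: u) n = a * u n. Proof. by []. Qed.

Definition supnorm (u : cseq) : R := sup (range (fun n => `|u n|)).

Lemma supnorm_has_sup (u : cseq) : has_sup (range (fun n => `|u n|)).
Proof.
split; first by exists `|u 0|, 0%N.
have /cvg_seq_bounded/pinfty_ex_gt0[M _ /= uM] := @cseq_cvg u.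
by exists M => _ [n _ <-]; exact: uM.
Qed.

Lemma le_supnorm (u : cseq) n : `|u n| <= supnorm u.
Proof. by apply: (sup_upper_bound (supnorm_has_sup u)); exists n. Qed.

Lemma supnorm_le (u : cseq) M : (forall n, `|u n| <= M) -> supnorm u <= M.
Proof.
by move=> uM; apply: sup_le_ub => [|_ [n _ <-]//]; exists `|u 0|, 0%N.
Qed.

Fact supnormD (u v : cseq) : supnorm (u + v) <= supnorm u + supnorm v.
Proof.
apply: supnorm_le => n; rewrite cseqDE.
by apply: le_trans (ler_normD _ _) _; rewrite lerD// le_supnorm.
Qed.

(** For [a != 0], the bound [<=] applied to [a^-1] and [a *: u] gives [>=]. *)
Fact supnormZ (a : R) (u : cseq) : supnorm (a *: u) = `|a| * supnorm u.
Proof.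
have le_supnormZ b w : supnorm (b *: w) <= `|b| * supnorm w.
  by apply: supnorm_le => n; rewrite cseqZE normrM ler_wpM2l// le_supnorm.
apply/eqP; rewrite eq_le le_supnormZ /=.
have [->|a0] := eqVneq a 0.
  by rewrite normr0 mul0r (le_trans _ (le_supnorm _ 0%N)).
rewrite -ler_pdivlMl ?normr_gt0// -normfV.
by rewrite -[in leLHS](scalerK a0 u).
Qed.

Fact supnorm_eq0 (u : cseq) : supnorm u = 0 -> u = 0.
Proof.
move=> u0; apply/val_inj/funext => n; apply/eqP.
by rewrite -normr_le0 -u0 le_supnorm.
Qed.

HB.instance Definition _ :=
  Lmodule_isNormed.Build R cseq supnormD supnormZ supnorm_eq0.

(** A Cauchy filter on [c] is Cauchy for uniform convergence of functions on
    [nat], which is complete, so it has a uniform limit [g]; exchanging the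
    limits along [F] and along the index shows that [g] converges. *)
Fact cseq_complete (F : set_system cseq) : ProperFilter F -> cauchy F -> cvg F.
Proof.
move=> FF Fc.
pose val_unif (u : cseq) : arrow_uniform_type nat R^o := u.
have /cauchy_cvg/cvg_ex[/= g Fg] : cauchy (val_unif @ F).
  move=> W [B /=]; rewrite -entourage_ballE => -[e /= e0 Be] sB.
  move/cauchy_ballP : Fc => /(_ e e0) [[P Q] /= [FP FQ] PQ].
  exists (val_unif @` P, val_unif @` Q) => /=.
    by split => /=; [apply: filterS FP|apply: filterS FQ] => x ?; exists x.
  move=> [_ _] /= [[x Px <-] [y Qy <-]]; apply: sB => /= t; apply: Be => /=.
  have := PQ (x, y) (conj Px Qy); rewrite /= -!ball_normE /=.
  by apply: le_lt_trans; rewrite -cseqBE le_supnorm.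
have [l [_ gl]] :=
  cvg_switch FF (eventually_filter : ProperFilter \oo) Fg (@cseq_cvg).
have gc : g \in convergent by apply/asboolP/cvg_ex; exists l.
apply/cvg_ex; exists (Cseq gc); apply/cvgrPdist_le => e e0.
have /cvg_fct_entourageP/(_ _ (entourage_ball R^o (PosNum e0)))/= Fe := Fg.
near=> u; apply: supnorm_le => n; rewrite cseqBE.
have /(_ n) : forall t, ball (g t) e (u t) by near: u; exact: Fe.
by rewrite -ball_normE /= => /ltW.
Unshelve. all: by end_near. Qed.

HB.instance Definition _ := Uniform_isComplete.Build cseq cseq_complete.

End ConvergentSequences.

(** * The operator adding the limit *)

Section LimitFunctional.
Context (R : realType).

Definition addlim (x : l1sum R^o (cseq R)) : R^o := x.1 + limn x.2.

Lemma cvg_cseq (u : cseq R) : u n @[n --> \oo] --> limn u.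
Proof. exact: @cseq_cvg R u. Qed.

Lemma lim_cseqP (a : R) (u v : cseq R) :
  limn (a *: u + v : cseq R) = a * limn u + limn v.
Proof.
apply: cvg_lim => //.
apply: (@cvgD R R^o); last exact: cvg_cseq.
by apply: (@cvgZl_tmp R R^o); exact: cvg_cseq.
Qed.

Fact addlim_is_linear : linear addlim.
Proof.
move=> a x y; rewrite {1}/addlim.
have -> : (a *: x + y).1 = a * x.1 + y.1 by [].
have -> : (a *: x + y).2 = a *: x.2 + y.2 by [].
by rewrite lim_cseqP addrACA -mulrDr.
Qed.

HB.instance Definition _ :=
  GRing.isLinear.Build R (l1sum R^o (cseq R)) R^o *:%R addlim addlim_is_linear.

Lemma norm_lim_le (u : cseq R) : `|limn u| <= `|u|.
Proof.
rewrite -lim_norm; last exact: cseq_cvg.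
apply: limr_le; first by apply: is_cvg_norm; exact: cseq_cvg.
by near=> n; exact: le_supnorm.
Unshelve. all: by end_near. Qed.

Lemma norm_addlim_le (x : l1sum R^o (cseq R)) : `|addlim x| <= `|x|.
Proof.
by rewrite (le_trans (ler_normD _ _))// lerD2l norm_lim_le.
Qed.

Lemma spike_cvg (t s : R) (m : nat) :
  (fun n => if n == m then s else t : R^o) @ \oo --> (t : R^o).
Proof.
apply/cvgrPdist_le => e e0.
near=> n; case: eqP => [nm|]; last by rewrite subrr normr0 ltW.
suff : (m < n)%N by rewrite nm ltnn.
by near: n; exists m.+1.
Unshelve. all: by end_near. Qed.

Lemma spike_convergent (t s : R) (m : nat) :
  (fun n => if n == m then s else t : R^o) \in @convergent R.
Proof. by apply/asboolP/cvg_ex; exists t; exact: spike_cvg. Qed.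

End LimitFunctional.

(** Away from an index [m] where [x.2] almost attains its norm, [v] is
    constantly [t = T y]: the limit of [v] sees only that constant, while the
    coordinate [m] alone bounds the norm of [x.2 + v] from below. *)
Lemma addlim_strong_daugavet (R : realType) :
  strong_daugavet (@addlim R : {linear l1sum R^o (cseq R) -> R^o}).
Proof.
split.
  apply/bounded_funP => r; exists r => x xr.
  exact: le_trans (norm_addlim_le x) xr.
move=> x y x1 y1 eps eps0.
pose t : R := @addlim R y.
have t1 : `|t| <= 1 by rewrite -y1 norm_addlim_le.
have [_ [m _ <-] xm] := sup_adherent eps0 (supnorm_has_sup x.2).
pose s : R := if 0 <= x.2 m then 1 else -1.
have s1 : `|s| = 1 by rewrite /s; case: ifP; rewrite ?normrN normr1.
pose v : cseq R := Cseq (spike_convergent t s m).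
have vm : v m = s by rewrite /v /= eqxx.
have v1 : `|v| = 1.
  apply/eqP; rewrite eq_le; apply/andP; split; last first.
    by rewrite -s1 -vm; exact: le_supnorm.
  by apply: supnorm_le => n; rewrite /v /=; case: ifP => _ //; rewrite s1.
exists ((0, v) : l1sum R^o (cseq R)); split.
- by rewrite l1sum_normE /= normr0 add0r v1.
- have xvm : `|x.2 m| + 1 <= `|x.2 + v|.
    suff <- : `|(x.2 + v) m| = `|x.2 m| + 1 by exact: le_supnorm.
    rewrite cseqDE vm /s; have [xm0|xm0] := leP 0 (x.2 m).
      by rewrite !ger0_norm// addr_ge0.
    rewrite (ltr0_norm xm0) ltr0_norm ?opprB 1?addrC//.
    by rewrite -(addr0 0) ltrD// oppr_lt0 ltr01.
  rewrite l1sum_normE [_.1]addr0 -[_.2]/(x.2 + v).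
  have -> : 2 - eps = `|x.1| + (`|x.2| - eps + 1).
    by rewrite !addrA -l1sum_normE x1 addrAC.
  by rewrite lerD2l (le_trans _ xvm)// lerD2r ltW.
- rewrite linearB /= {2}/addlim add0r /= (_ : limn v = t) ?subrr ?normr0 ?ltW//.
  by apply: cvg_lim => //; exact: spike_cvg.
Qed.

(** * The counterexample *)

Theorem proposition4p5 (R : realType) :
  exists (X1 X2 Y : completeNormedModType R) (T : {linear l1sum X1 X2 -> Y}),
    strong_daugavet T /\
    ~ strong_daugavet (T \o @l1inl R X1 X2 : {linear X1 -> Y}).
Proof.
exists R^o, (cseq R), R^o, (@addlim R).
split; first exact: addlim_strong_daugavet.
have restrE (a : R^o) : addlim (l1inl (cseq R) a) = a.
  rewrite /addlim /= (_ : limn _ = 0) ?addr0//.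
  by apply: cvg_lim => //; exact: cvg_cst.
(* Any [eps < 1] makes [2 - eps <= |1 + z| <= eps] impossible. *)
move=> [_ /(_ 1 (-1))]; rewrite normrN normr1.
move=> /(_ erefl erefl 2^-1); rewrite invr_gt0 ltr0n => /(_ isT)[z [_]].
by rewrite /= restrE -opprD normrN => le1 /(le_trans le1); lra.
Qed.
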